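(* Let $(c_k)_{k\ge 0}$ be a sequence in a field $\mathbb{K}$ such that $c_0\neq 0$; $c_{2m}=0$ for all integers $m\ge 1$; $H_n(c_{k+1})\neq 0$ for all $n=0,1,2,\ldots$; and $H_n(c_k)\ne 0$ for all $n=0,1,2,\ldots$ (so that the monic orthogonal polynomials with respect to $(c_k)$ exist). Let $P_n(y)$, $n\ge 0$, be the monic orthogonal polynomials with respect to $(c_k)_{k\ge0}$, with three-term recurrence $$P_0(y)=1,\qquad P_1(y)=y+s_0,\qquad P_{n+1}(y)=(y+s_n)P_n(y)+t_nP_{n-1}(y)\quad (n\ge 1),$$ and for $n\ge 1$ let $d_n$ be the coefficient of $y^{n-1}$ in $P_n(y)$, i.e. $P_n(y)=y^n+d_ny^{n-1}+\text{lower-degree terms}$. Then $t_n=d_n^2$ for all $n\ge 1$.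
   Context: For a sequence $(c_k)_{k\ge 0}$, the Hankel determinants are $H_n(c_k):=\det(c_{i+j})_{0\le i,j\le n}$, and those of the shifted sequence $(c_{k+1})_{k\ge0}$ are $H_n(c_{k+1}):=\det(c_{i+j+1})_{0\le i,j\le n}$. Let $L$ be the linear functional on polynomials in $y$ with $L(y^k)=c_k$ for $k\ge0$. If $H_n(c_k)\ne 0$ for all $n\ge 0$, there is a unique sequence of monic polynomials $P_n(y)$ with $\deg P_n=n$ and nonzero $\zeta_n$ such that $L(P_m(y)P_n(y))=\zeta_n\delta_{m,n}$ for all $m,n\geq 0$; these are called the monic orthogonal polynomials with respect to $(c_k)$. They satisfy a three-term recurrence of the form displayed in the claim, which defines $(s_n)_{n\ge0}$ and $(t_n)_{n\ge1}$. *)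

(* Defs.v *)
From HB Require Import structures.
From mathcomp Require Import all_boot all_order all_algebra.

Set Implicit Arguments.
Unset Strict Implicit.
Unset Printing Implicit Defensive.

Import GRing.Theory.
Local Open Scope ring_scope.

(* The matrix has size n + 1: indices run over 0 <= i, j <= n. *)
Definition hankel (K : fieldType) (c : nat -> K) (n : nat) : K :=
  \det (\matrix_(i < n.+1, j < n.+1) c (i + j)%N).

Definition shift (K : fieldType) (c : nat -> K) : nat -> K := fun k => c k.+1.

(* [moment c] is the linear functional L on K[y] with L(y^k) = c_k
   (see the instance and [momentXn] below). *)
Definition moment (K : fieldType) (c : nat -> K) (p : {poly K}) : K :=
  \sum_(i < size p) p`_i * c i.

Lemma moment_is_scalar (K : fieldType) (c : nat -> K) : scalar (moment c).
Proof.
have widen n (p : {poly K}) : (size p <= n)%N ->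
    moment c p = \sum_(i < n) p`_i * c i.
  move=> le_pn; rewrite /moment (big_ord_widen n (fun i => p`_i * c i) le_pn).
  rewrite big_mkcond; apply: eq_bigr => i _.
  by case: ltnP => // le_pi; rewrite nth_default ?mul0r.
move=> a p q; set n := maxn (size p) (size q).
have le_pn : (size p <= n)%N := leq_maxl _ _.
have le_qn : (size q <= n)%N := leq_maxr _ _.
rewrite (widen n p) // (widen n q) // (widen n); last first.
  apply: leq_trans (size_polyD _ _) _; rewrite geq_max le_qn andbT.
  exact: leq_trans (size_scale_leq _ _) le_pn.
rewrite mulr_sumr -big_split; apply: eq_bigr => i _ /=.
by rewrite coefD coefZ mulrDl mulrA.
Qed.

HB.instance Definition _ (K : fieldType) (c : nat -> K) :=
  GRing.isLinear.Build K {poly K} K *%R (moment c) (moment_is_scalar c).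

Lemma momentXn (K : fieldType) (c : nat -> K) (k : nat) : moment c 'X^k = c k.
Proof.
rewrite /moment size_polyXn big_ord_recr /= big1 => [|i _].
  by rewrite add0r coefXn eqxx mul1r.
by rewrite coefXn ltn_eqF ?mul0r.
Qed.

Definition monic_orthogonal (K : fieldType) (c : nat -> K)
    (P : nat -> {poly K}) : Prop :=
  (forall n, P n \is monic /\ size (P n) = n.+1) /\
  exists zeta : nat -> K,
    (forall n, zeta n != 0) /\
    (forall m n, moment c (P m * P n) = if m == n then zeta n else 0).

(* [t 0] is irrelevant: the recurrence only constrains [t n] for n >= 1. *)
Definition three_term (K : fieldType) (P : nat -> {poly K})
    (s t : nat -> K) : Prop :=
  [/\ P 0%N = 1,
      P 1%N = 'X + (s 0%N)%:P
    & forall n, (1 <= n)%N ->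
        P n.+1 = ('X + (s n)%:P) * P n + (t n)%:P * P n.-1].

(* Main.v *)
(* Since the even moments beyond c_0 vanish, the combination
   P_n(0) P_{n+1} - P_{n+1}(0) P_n, which is y times an orthogonal polynomial of
   the symmetric functional f |-> L(y f), has only powers of y of one parity.
   Its coefficient of y^n is therefore 0, i.e. P_{n+1}(0) = d_{n+1} P_n(0).
   Substituting this and s_n = d_{n+1} - d_n in the recurrence at y = 0, and
   dividing by P_{n-1}(0), which is nonzero because H_n(c_{k+1}) is, gives the
   claim. *)
Require Import Defs.
From HB Require Import structures.
From mathcomp Require Import all_boot all_order all_algebra.

Set Implicit Arguments.
Unset Strict Implicit.
Unset Printing Implicit Defensive.

Import GRing.Theory.
Local Open Scope ring_scope.

Lemma momentMXn (K : fieldType) (c : nat -> K) (n i : nat) (p : {poly K}) :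
  (size p <= n)%N -> moment c (p * 'X^i) = \sum_(j < n) p`_j * c (j + i)%N.
Proof.
move=> le_pn; have -> : p = \poly_(j < n) p`_j.
  apply/polyP=> j; rewrite coef_poly; case: ltnP => // le_nj.
  by rewrite nth_default // (leq_trans le_pn).
rewrite poly_def mulr_suml linear_sum; apply: eq_bigr => j _ /=.
by rewrite -scalerAl -exprD linearZ /= momentXn -poly_def coef_poly ltn_ord.
Qed.

(** Subtracting a multiple of the monic [P k] removes the coefficient of y^k, so by induction [p]
    reduces to a combination of the [P k] with k < n. *)
Lemma monic_orthogonal_moment (K : fieldType) (c : nat -> K)
    (P : nat -> {poly K}) (n : nat) (p : {poly K}) :
  monic_orthogonal c P -> (size p <= n)%N -> moment c (P n * p) = 0.
Proof.
move=> [monP [zeta [_ orthP]]].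
have step k (q : {poly K}) :
    (size q <= k)%N -> (k <= n)%N -> moment c (P n * q) = 0.
  elim: k q => [|k IHk] q le_qk le_kn.
    by move: le_qk; rewrite leqn0 size_poly_eq0 => /eqP->; rewrite mulr0 linear0.
  have [/monicP Pk1 sz_Pk] := monP k.
  have -> : q = (q - q`_k *: P k) + q`_k *: P k by rewrite subrK.
  rewrite mulrDr -scalerAr linearD [X in _ + X]linearZ /= orthP gtn_eqF //.
  rewrite mulr0 addr0; apply: IHk; last exact: ltnW.
  apply/leq_sizeP => j le_kj; rewrite coefB coefZ.
  move: le_kj; rewrite leq_eqVlt => /orP[/eqP<- | lt_kj].
    by move: Pk1; rewrite lead_coefE sz_Pk /= => ->; rewrite mulr1 subrr.
  rewrite nth_default ?(leq_trans le_qk) // [(P k)`_j]nth_default ?sz_Pk //.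
  by rewrite mulr0 subrr.
by move=> le_pn; apply: (step n).
Qed.

(** Write u = y v with deg v < n. The n moment conditions say that the coefficient row of v is
    annihilated by the n by n Hankel matrix of the shifted sequence, which is invertible. *)
Lemma hankel_shift_kernel (K : fieldType) (c : nat -> K) (n : nat)
    (u : {poly K}) :
  (forall m, hankel (shift c) m != 0) -> (size u <= n.+1)%N -> u`_0 = 0 ->
  (forall i, (i < n)%N -> moment c (u * 'X^i) = 0) -> u = 0.
Proof.
move=> hH1 sz_u u0 momu; apply/polyP=> j; rewrite coef0.
case: j => [//|j]; case: (ltnP j n) => [lt_jn|le_nj]; last first.
  by rewrite nth_default // (leq_trans sz_u).
(* [hankel (shift c) m] has size m + 1, hence n = m + 1; for n = 0 no index j < n exists. *)
case: n => [//|m] in sz_u momu lt_jn *.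
pose A : 'M[K]_m.+1 := \matrix_(i, k) shift c (i + k).
pose v : 'rV[K]_m.+1 := \row_k u`_k.+1.
have vA0 : v *m A = 0.
  apply/rowP=> i; rewrite !mxE -[RHS](momu i) // (momentMXn _ _ sz_u).
  rewrite [RHS]big_ord_recl /= u0 mul0r add0r; apply: eq_bigr => k _.
  by rewrite !mxE /shift.
have A_unit : A \in unitmx by rewrite unitmxE unitfE; apply: hH1.
have /rowP/(_ (Ordinal lt_jn)) : v = 0.
  by rewrite -(mulmxK A_unit v) vA0 mul0mx.
by rewrite !mxE.
Qed.

Section VanishingEvenMoments.

Variables (K : fieldType) (c : nat -> K).
Hypothesis hceven : forall m : nat, (1 <= m)%N -> c (2 * m)%N = 0.
Hypothesis hH1 : forall n : nat, hankel (shift c) n != 0.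
Variable P : nat -> {poly K}.
Hypothesis hP : monic_orthogonal c P.

Lemma even_moment_eq0 k : (0 < k)%N -> ~~ odd k -> c k = 0.
Proof.
move=> k_gt0 /even_halfK def_k; rewrite -def_k -mul2n hceven //.
by rewrite -double_gt0 def_k.
Qed.

(** A zero constant term would put [P n] under [hankel_shift_kernel], forcing a monic polynomial to
    vanish. *)
Lemma orthogonal_coef0_neq0 n : (P n)`_0 != 0.
Proof.
apply/eqP=> Pn0; have [monP _] := hP; have [mon_n sz_n] := monP n.
suff Pn_eq0 : P n = 0 by have := monic_neq0 mon_n; rewrite Pn_eq0 eqxx.
apply: (@hankel_shift_kernel _ c n) => [//||//|i lt_in]; first by rewrite sz_n.
by apply: (monic_orthogonal_moment hP); rewrite size_polyXn.
Qed.

Lemma orthogonal_coef0S n : (P n.+1)`_0 = (P n.+1)`_n * (P n)`_0.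
Proof.
have [monP _] := hP.
pose w := (P n)`_0 *: P n.+1 - (P n.+1)`_0 *: P n.
have w0 : w`_0 = 0 by rewrite coefB !coefZ mulrC subrr.
have sz_w : (size w <= n.+2)%N.
  apply/leq_sizeP => j le_nj; rewrite coefB !coefZ.
  rewrite [(P n.+1)`_j]nth_default ?(monP _).2 //.
  by rewrite [(P n)`_j]nth_default ?(monP _).2 ?mulr0 ?subrr // ltnW.
have momw i : (i < n)%N -> moment c (w * 'X^i) = 0.
  move=> lt_in; rewrite mulrBl -!scalerAl linearB !linearZ /=.
  rewrite !(monic_orthogonal_moment hP) ?size_polyXn ?mulr0 ?subrr //.
  exact: ltnW.
(* [u] is the part of [w] with exponents of the parity of n. The exponent n + 1 has the other
   parity, so [u] meets the size bound of [hankel_shift_kernel], which [w] may exceed. *)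
pose u := \poly_(j < n.+1) (if odd (j + n) then 0 else w`_j).
have u_eq0 : u = 0.
  apply: (@hankel_shift_kernel _ c n) => // [||i lt_in].
  - exact: size_poly.
  - by rewrite coef_poly /= w0 if_same.
  have sz_u : (size u <= n.+2)%N by rewrite (leq_trans (size_poly _ _)).
  rewrite (momentMXn _ _ sz_u).
  have coef_u j : (j < n.+2)%N -> u`_j = if odd (j + n) then 0 else w`_j.
    rewrite coef_poly ltnS leq_eqVlt => /orP[/eqP-> | ->] //.
    by rewrite ltnn addSn /= oddD addbb.
  (* If i + n is even, every surviving j has i + j even, so its moment vanishes unless j = 0, where
     [w0] applies. *)
  case odd_in : (odd (i + n)); last first.
    rewrite big1 // => j _; rewrite coef_u //.
    case odd_jn : (odd (j + n)); first by rewrite mul0r.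
    case: (posnP j) => [->|j_gt0]; first by rewrite w0 mul0r.
    rewrite even_moment_eq0 ?mulr0 ?addn_gt0 ?j_gt0 //.
    by move: odd_in odd_jn; rewrite !oddD; do 3!case: odd.
  (* If i + n is odd, it is the discarded terms that have i + j even, so [u] and [w] have the same
     moment against y^i. *)
  rewrite -[RHS](momw i lt_in) (momentMXn _ _ sz_w); apply: eq_bigr => j _.
  rewrite coef_u //; case odd_jn : (odd (j + n)) => //; rewrite mul0r.
  case: (posnP j) => [->|j_gt0]; first by rewrite w0 mul0r.
  rewrite even_moment_eq0 ?mulr0 ?addn_gt0 ?j_gt0 //.
  by move: odd_in odd_jn; rewrite !oddD; do 3!case: odd.
have : w`_n = 0.
  move: (congr1 (fun q : {poly K} => q`_n) u_eq0).
  by rewrite coef_poly ltnSn oddD addbb coef0.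
have [/monicP Pn1 sz_n] := monP n.
move: Pn1; rewrite lead_coefE sz_n /= coefB !coefZ => ->.
by rewrite mulr1 mulrC => /eqP; rewrite subr_eq0 => /eqP.
Qed.

End VanishingEvenMoments.

Theorem theorem11 (K : fieldType) (c : nat -> K)
  (hc0 : c 0%N != 0)
  (hceven : forall m : nat, (1 <= m)%N -> c (2 * m)%N = 0)
  (hH1 : forall n : nat, hankel (shift c) n != 0)
  (hH0 : forall n : nat, hankel c n != 0)
  (P : nat -> {poly K}) (hP : monic_orthogonal c P)
  (s t : nat -> K) (hrec : three_term P s t)
  (d : nat -> K) (hd : forall n : nat, (1 <= n)%N -> d n = (P n)`_n.-1) :
  forall n : nat, (1 <= n)%N -> t n = d n ^+ 2.
Proof.
move=> [//|n] _; have [_ _ recP] := hrec; have [monP _] := hP.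
have dS k : (P k.+1)`_0 = d k.+1 * (P k)`_0.
  by rewrite hd // (orthogonal_coef0S hceven hH1 hP).
(* Compare the coefficients of y^(n+1) in the recurrence for [P n.+2]; the t-term has degree at most
   n. *)
have sE : s n.+1 = d n.+2 - d n.+1.
  have [/monicP Pn1 sz_n] := monP n.+1.
  rewrite !hd //= recP //= coefD mulrDl coefD coefXM !coefCM /=.
  move: Pn1; rewrite lead_coefE sz_n /= => ->.
  rewrite [(P n)`_n.+1]nth_default ?(monP n).2 // mulr0 addr0 mulr1.
  by rewrite addrC addKr.
(* With a = P_n(0), the constant terms give d_{n+2} d_{n+1} a = (d_{n+2} - d_{n+1}) d_{n+1} a +
   t_{n+1} a. *)
have := congr1 (fun q : {poly K} => q`_0) (recP n.+1 isT).
rewrite /= coefD mulrDl coefD coefXM !coefCM /= add0r !dS sE.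
rewrite !mulrA -mulrDl => /(mulIf (orthogonal_coef0_neq0 hH1 hP n)) /eqP.
rewrite mulrBl -addrA -subr_eq0 opprD addNKr opprD opprK subr_eq0.
by rewrite eq_sym => /eqP.
Qed.
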